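(* Let $A$ be a ring and $M$ an $A$-bimodule such that $ann_l(M)\subseteq ann_r(M)$. Then the trivial extension $A\propto M$ is a left fusible ring if and only if $A$ is a left fusible ring and $M=0$.
   Context: Rings are associative with identity, not necessarily commutative. For an $A$-bimodule $M$, $ann_l(M)=\{x\in A: xM=0\}$ and $ann_r(M)=\{x\in A: Mx=0\}$. The trivial extension $A\propto M=\{(a,m): a\in A, m\in M\}$ is the ring with componentwise addition, multiplication $(a,m)(b,m')=(ab,am'+mb)$ and identity $(1,0)$. An element $a$ of a ring is a left zero divisor if $ax=0$ for some nonzero $x$ in the ring (so $0$ is a left zero divisor in a nonzero ring). A nonzero element $a$ of a ring is left fusible if $a=z+r$ with $z$ a left zero divisor and $r$ not a left zero divisor; a ring is left fusible if each of its nonzero elements is left fusible. *)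

(* Defs.v *)
From HB Require Import structures.
From mathcomp Require Import all_boot all_order all_algebra.

Set Implicit Arguments.
Unset Strict Implicit.
Unset Printing Implicit Defensive.

Import GRing.Theory.
Local Open Scope ring_scope.

(* pzRingType (rather than nzRingType) is used throughout, so that the zero
   ring is allowed. *)

(* An A-bimodule (unital on both sides): a left A-module together with a
   compatible right action of A. *)
HB.mixin Record Lmodule_isBimodule (A : pzRingType) M of GRing.Lmodule A M := {
  ract : M -> A -> M;
  ractA : forall m a b, ract (ract m a) b = ract m (a * b);
  ract1 : forall m, ract m 1 = m;
  ractDl : forall a m n, ract (m + n) a = ract m a + ract n a;
  ractDr : forall m a b, ract m (a + b) = ract m a + ract m b;
  scale_ract : forall a m b, a *: ract m b = ract (a *: m) b
}.

#[short(type="bimodType")]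
HB.structure Definition Bimodule (A : pzRingType) :=
  {M of GRing.Lmodule A M & Lmodule_isBimodule A M}.

Notation "m :* a" := (ract m a) : ring_scope.

Definition ann_l (A : pzRingType) (M : bimodType A) (x : A) : Prop :=
  forall m : M, x *: m = 0.

Definition ann_r (A : pzRingType) (M : bimodType A) (x : A) : Prop :=
  forall m : M, m :* x = 0.

(* An alias of A * M, so that its ring structure does not interfere with the
   componentwise product structures on pairs. *)
Definition trivial_ext (A : pzRingType) (M : bimodType A) : Type :=
  (A * M)%type.

Section TrivialExtension.
Variables (A : pzRingType) (M : bimodType A).
Implicit Types u v w : trivial_ext M.

HB.instance Definition _ := GRing.Zmodule.copy (trivial_ext M) (A * M)%type.

Definition te_one : trivial_ext M := (1, 0).

Definition te_mul u v : trivial_ext M :=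
  (u.1 * v.1, u.1 *: v.2 + u.2 :* v.1).

Lemma ract0 (m : M) : m :* (0 : A) = 0.
Proof. by apply: (addrI (m :* 0)); rewrite -ractDr !addr0. Qed.

Lemma ract0l (a : A) : (0 : M) :* a = 0.
Proof. by apply: (addrI ((0 : M) :* a)); rewrite -ractDl !addr0. Qed.

Lemma te_mulA : associative te_mul.
Proof.
move=> [a m] [b n] [c p]; rewrite /te_mul /=; congr pair; first exact: mulrA.
by rewrite scalerDr scalerA scale_ract ractDl ractA addrA.
Qed.

Lemma te_mul1r : left_id te_one te_mul.
Proof. by case=> a m; rewrite /te_mul /= mul1r scale1r ract0l addr0. Qed.

Lemma te_mulr1 : right_id te_one te_mul.
Proof. by case=> a m; rewrite /te_mul /= mulr1 scaler0 ract1 add0r. Qed.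

Lemma te_mulDl : left_distributive te_mul +%R.
Proof.
move=> [a m] [b n] [c p]; rewrite /te_mul /=; congr pair; first exact: mulrDl.
by rewrite scalerDl ractDl addrACA.
Qed.

Lemma te_mulDr : right_distributive te_mul +%R.
Proof.
move=> [a m] [b n] [c p]; rewrite /te_mul /=; congr pair; first exact: mulrDr.
by rewrite scalerDr ractDr addrACA.
Qed.

HB.instance Definition _ := GRing.Zmodule_isPzRing.Build (trivial_ext M)
  te_mulA te_mul1r te_mulr1 te_mulDl te_mulDr.

End TrivialExtension.

Definition left_zero_divisor (R : pzRingType) (a : R) : Prop :=
  exists2 x : R, x != 0 & a * x = 0.

Definition left_fusible_elt (R : pzRingType) (a : R) : Prop :=
  exists z r : R, [/\ left_zero_divisor z, ~ left_zero_divisor r & a = z + r].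

Definition left_fusible (R : pzRingType) : Prop :=
  forall a : R, a != 0 -> left_fusible_elt a.

(* Main.v *)
Require Import Defs.
From mathcomp Require Import all_boot all_order all_algebra.
Import GRing.Theory.
Local Open Scope ring_scope.

(** The substance is that a left fusible trivial extension has [M = 0].
    An element [(0, m)] can only be split as [(a, n) + (b, p)] with [b = - a],
    so both first components kill the same elements of [A] and of [M].
    Since [(b, p)] is not a left zero divisor, [a] kills no nonzero element of
    [M].  A nonzero pair killed by [(a, n)] must then have a nonzero first
    component [x], with [a * x = 0]; as [a] kills every [x *: q], the element
    [x] kills [M] on the left, hence also on the right by the annihilator
    hypothesis.  But then [(b, p)] kills [(x, 0)], a contradiction
    ([trivial_ext_pair0_not_fusible]).

    Once [M = 0], the first projection identifies the trivial extension with
    [A] and fusibility passes both ways ([left_fusible_trivial_ext0]). *)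

Section ZeroModule.
Variables (A : pzRingType) (M : bimodType A).
Hypothesis M0 : forall m : M, m = 0.

Lemma trivial_ext0_eq (u v : trivial_ext M) : u.1 = v.1 -> u = v.
Proof. by case: u v => [a m] [b n] /= ->; rewrite (M0 m) (M0 n). Qed.

Lemma trivial_ext0_fst_neq0 (u : trivial_ext M) : u != 0 -> u.1 != 0.
Proof. by apply: contra_neq => u0; apply: trivial_ext0_eq. Qed.

Lemma left_zero_divisor_trivial_ext0 (u : trivial_ext M) :
  left_zero_divisor u <-> left_zero_divisor u.1.
Proof.
split=> [[v v0 uv0]|[x x0 ux0]].
  exists v.1; first exact: trivial_ext0_fst_neq0.
  by case: uv0.
exists ((x, 0) : trivial_ext M); last exact: trivial_ext0_eq.
by apply: contra_neq x0 => -[].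
Qed.

Lemma left_fusible_elt_trivial_ext0 (u : trivial_ext M) :
  left_fusible_elt u <-> left_fusible_elt u.1.
Proof.
split=> [[z [r [zd nzd ->]]]|[z [r [zd nzd def_u]]]].
  exists z.1, r.1; split=> //; first exact/left_zero_divisor_trivial_ext0.
  by move/left_zero_divisor_trivial_ext0.
exists ((z, 0) : trivial_ext M), ((r, 0) : trivial_ext M); split.
- exact/left_zero_divisor_trivial_ext0.
- by move/left_zero_divisor_trivial_ext0.
- exact: trivial_ext0_eq.
Qed.

Lemma left_fusible_trivial_ext0 : left_fusible (trivial_ext M) <-> left_fusible A.
Proof.
split=> fus.
  move=> a a0; apply/(left_fusible_elt_trivial_ext0 (a, 0))/fus.
  by apply: contra_neq a0 => -[].
by move=> u u0; apply/left_fusible_elt_trivial_ext0/fus/trivial_ext0_fst_neq0.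
Qed.

End ZeroModule.

(** An element [p] of [M] gives the pair [(0, p)], which [u] multiplies to
    [(0, u.1 *: p)], whatever [u.2] is. *)
Lemma not_left_zero_divisor_scale_inj (A : pzRingType) (M : bimodType A)
    (u : trivial_ext M) (p : M) :
  ~ left_zero_divisor u -> u.1 *: p = 0 -> p = 0.
Proof.
move=> nzd up0; have [//|p0] := eqVneq p 0; case: nzd.
exists ((0, p) : trivial_ext M); first by apply: contra_neq p0 => -[].
by congr pair; rewrite /= ?mulr0 // up0 ract0 addr0.
Qed.

(** In a decomposition of [(0, m)] the summands have opposite first components;
    the annihilator hypothesis then forces any pair killed by the first summand
    to have the form [(x, 0)] and to be killed by the second one as well. *)
Lemma trivial_ext_pair0_not_fusible (A : pzRingType) (M : bimodType A)
    (hann : forall x : A, ann_l M x -> ann_r M x) (m : M) :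
  ~ left_fusible_elt ((0, m) : trivial_ext M).
Proof.
case=> -[a n] [[b p] [[[x q] xq0 [ax0 aq0]] nzd [/esym/eqP ab0 _]]].
move: ab0; rewrite addrC addr_eq0 => /eqP def_b.
have a_inj (k : M) : a *: k = 0 -> k = 0.
  move=> ak0; apply: not_left_zero_divisor_scale_inj nzd _.
  by rewrite /= def_b scaleNr ak0 oppr0.
have xM0 : ann_l M x.
  by move=> k; apply: a_inj; rewrite scalerA ax0 scale0r.
have Mx0 := hann x xM0.
have q0 : q = 0.
  by apply: a_inj; move: aq0; rewrite /= Mx0 addr0.
case: nzd; exists ((x, q) : trivial_ext M) => //.
by congr pair; rewrite /= def_b ?mulNr ?ax0 ?oppr0 // q0 scaler0 Mx0 addr0.
Qed.

Theorem theorem6 (A : pzRingType) (M : bimodType A)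
    (hann : forall x : A, ann_l M x -> ann_r M x) :
  left_fusible (trivial_ext M) <-> left_fusible A /\ (forall m : M, m = 0).
Proof.
split=> [fus|[fus M0]]; last exact/(left_fusible_trivial_ext0 _ _ M0).
have M0 (m : M) : m = 0.
  have [//|m0] := eqVneq m 0.
  case: (trivial_ext_pair0_not_fusible _ _ hann m).
  by apply: fus; apply: contra_neq m0 => -[].
by split=> //; apply/(left_fusible_trivial_ext0 _ _ M0).
Qed.
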